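(* Let $(\mathcal{M},\rho)$ be a pseudometric space and let $X$ be a (real) Banach space with $\dim X>1$ and closed unit ball $B_X$. Let $\mathcal{K}_1(X)$ be the family of all non-empty convex compact subsets of $X$ of dimension at most $1$. Let $F:\mathcal{M}\to\mathcal{K}_1(X)$ be a set-valued mapping such that for every subset $\mathcal{M}'\subset\mathcal{M}$ with $\#\mathcal{M}'\le 4$ the restriction $F|_{\mathcal{M}'}$ has a Lipschitz selection with Lipschitz seminorm at most $1$. For real numbers $\lambda_1,\lambda_2$ and $x\in\mathcal{M}$ define $$F^{[1]}(x)=\bigcap_{z\in\mathcal{M}}\left[F(z)+\lambda_1\rho(x,z)B_X\right],\qquad F^{[2]}(x)=\bigcap_{z\in\mathcal{M}}\left[F^{[1]}(z)+\lambda_2\rho(x,z)B_X\right].$$ Then, whenever $$\lambda_1\ge 1,\qquad \lambda_2\ge 3\lambda_1,\qquad \gamma\ge\lambda_2\,\frac{3\lambda_2+\lambda_1}{\lambda_2-\lambda_1},$$ one has $F^{[2]}(x)\ne\emptyset$ for every $x\in\mathcal{M}$ and $$d_H(F^{[2]}(x),F^{[2]}(y))\le\gamma\,\rho(x,y)\quad\text{for every }x,y\in\mathcal{M}.$$ In particular, this holds for $\lambda_1=1$, $\lambda_2=3$, $\gamma=15$. If $X$ is a Euclidean space, the same two conclusions hold whenever $\lambda_1,\lambda_2,\gamma$ satisfy the weaker condition $$\lambda_1\ge1,\qquad\lambda_2\ge3\lambda_1,\qquad\gamma\ge\lambda_2+\frac{2\lambda_2^2}{(\lambda_2^2-\lambda_1^2)^{1/2}};$$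 in particular, in this case they hold for $\lambda_1=1$, $\lambda_2=3$, $\gamma=10$.
   Context: A pseudometric space $(\mathcal{M},\rho)$ is a set $\mathcal{M}$ with $\rho:\mathcal{M}\times\mathcal{M}\to[0,+\infty]$ satisfying $\rho(x,x)=0$, $\rho(x,y)=\rho(y,x)$ and $\rho(x,y)\le\rho(x,z)+\rho(z,y)$; $\rho(x,y)=0$ with $x\ne y$ and $\rho(x,y)=+\infty$ are allowed. When $r=+\infty$, $A+rB_X$ means $X$ for $A\neq\emptyset$ (and $\lambda\cdot(+\infty)=+\infty$ for $\lambda>0$). A convex set has dimension at most $1$ if it is contained in an affine subspace of dimension at most $1$; thus $\mathcal{K}_1(X)$ consists of all points and all bounded closed line segments of $X$. A selection of $F$ on $\mathcal{M}'$ is a map $f:\mathcal{M}'\to X$ with $f(x)\in F(x)$ for all $x\in\mathcal{M}'$. The Lipschitz seminorm is $\|f\|_{\mathrm{Lip}(\mathcal{M}',X)}=\inf\{\lambda>0:\|f(x)-f(y)\|\le\lambda\rho(x,y)\ \text{for all } x,y\in\mathcal{M}'\}$. The sum of sets is the Minkowski sum, $rB_X$ is the closed ball of radius $r$ centered at $0$, and the Hausdorff distance of non-empty bounded sets is $d_H(A,B)=\inf\{r>0: A+rB_X\supset B \text{ and } B+rB_X\supset A\}$. ''Euclidean'' means the norm is induced by an inner product. *)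

(* Defs.v *)
From HB Require Import structures.
From mathcomp Require Import all_boot all_order all_algebra.
From mathcomp Require Import all_classical all_reals all_analysis.
From mathcomp Require Import sesquilinear.
Import Order.TTheory GRing.Theory Num.Theory.
Import numFieldNormedType.Exports.

Set Implicit Arguments.
Unset Strict Implicit.
Unset Printing Implicit Defensive.

Local Open Scope classical_set_scope.
Local Open Scope ring_scope.

(* Pseudometrics take values in [0, +oo]; distinct points may be at distance
   0 or +oo, so this is not the library's [pseudoMetricType]. *)
Record is_pseudometric (R : realType) (M : Type) (rho : M -> M -> \bar R) :
    Prop := IsPseudometric {
  pseudometric_ge0 : forall x y, (0 <= rho x y)%E ;
  pseudometric_refl : forall x, rho x x = 0%E ;
  pseudometric_sym : forall x y, rho x y = rho y x ;
  pseudometric_triangle : forall x y z, (rho x y <= rho x z + rho z y)%E }.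

Definition dim_gt1 (R : realType) (X : lmodType R) : Prop :=
  exists u v : X, forall a b : R, a *: u + b *: v = 0 -> a = 0 /\ b = 0.

Definition euclidean (R : realType) (X : normedModType R) : Prop :=
  exists ip : {dot X for idfun}, forall x : X, `|x| ^+ 2 = ip x x.

(* The line through [p] with direction [v], or the point [p] when [v = 0]. *)
Definition affine_le1 (R : realType) (X : lmodType R) (p v : X) : set X :=
  [set p + t *: v | t in [set: R]].

Definition K1 (R : realType) (X : normedModType R) : set (set X) :=
  [set A | [/\ A !=set0, convex_set (A : set (convex_lmodType X)), compact A
             & exists p v : X, A `<=` affine_le1 p v]].
Arguments K1 {R} X.

(* The set r B_X for r in [0, +oo]: the whole space when r = +oo, and [set 0]
   when r = 0, which the library's [closed_ball] (the closure of an open ball)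
   does not give. *)
Definition cball0 (R : realType) (X : normedModType R) (r : \bar R) : set X :=
  [set b | (`|b|%:E <= r)%E].
Arguments cball0 {R} X r _.

Definition minkowski_sum (R : realType) (X : lmodType R) (A B : set X) :
    set X :=
  [set a + b | a in A & b in B].

Definition hausdorff_dist (R : realType) (X : normedModType R) (A B : set X) :
    \bar R :=
  ereal_inf [set r%:E | r in [set r : R | [/\ 0 < r,
    B `<=` minkowski_sum A (cball0 X r%:E) &
    A `<=` minkowski_sum B (cball0 X r%:E)]]].

(* The Lipschitz seminorm of the restriction of [f] to [M']; it is +oo when
   that restriction is not Lipschitz. *)
Definition lip_seminorm (R : realType) (M : Type) (rho : M -> M -> \bar R)
    (X : normedModType R) (M' : set M) (f : M -> X) : \bar R :=
  ereal_inf [set l%:E | l in [set l : R | 0 < l /\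
    forall x y, M' x -> M' y -> (`|f x - f y|%:E <= l%:E * rho x y)%E]].

Definition selection_on (M X : Type) (F : M -> set X) (M' : set M)
    (f : M -> X) : Prop :=
  forall x, M' x -> F x (f x).

Definition metric_refinement (R : realType) (M : Type) (rho : M -> M -> \bar R)
    (X : normedModType R) (l : R) (F : M -> set X) : M -> set X :=
  fun x => \bigcap_(z in [set: M])
    minkowski_sum (F z) (cball0 X (l%:E * rho x z)%E).

Definition core_property (R : realType) (M : Type) (rho : M -> M -> \bar R)
    (X : normedModType R) (F : M -> set X) (l1 l2 gamma : R) : Prop :=
  let F2 := metric_refinement rho l2 (metric_refinement rho l1 F) in
  (forall x, F2 x !=set0) /\
  (forall x y, (hausdorff_dist (F2 x) (F2 y) <= gamma%:E * rho x y)%E).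

(* Main.v *)
Require Import Defs.
From mathcomp Require Import all_boot all_order all_algebra.
From mathcomp Require Import all_classical all_reals all_analysis.
From mathcomp Require Import ring lra sesquilinear.
Import Order.TTheory GRing.Theory Num.Theory.
Import numFieldNormedType.Exports.

Set Implicit Arguments.
Unset Strict Implicit.
Unset Printing Implicit Defensive.

Local Open Scope classical_set_scope.
Local Open Scope ring_scope.

(** Everything rests on Helly's theorem on a line: inside a point or a segment,
    closed convex sets that meet pairwise have a common point ([helly_K1]).
    Since [F x] is such a set, and so contains both refinements at [x], every
    question about them reduces to pairs of conditions.

    Write [F1], [F2] for the two refinements, with factors [l] and [k].  A pair
    of conditions defining [F1 x] involves three points of [M], so a selection
    on three points gives [F1 x !=set0].  With four points, two nested uses of
    Helly's theorem show that [F1 z] and [F1 z'] come within [l * rho z z'] of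
    each other ([first_refinements_close]).

    For [F2 x] one needs, for all [z] and [z'], a point of [F x] close to both
    [F1 z] and [F1 z'].  Let [z] be the one nearer to [x], pick a point of
    [F1 z] close to [F1 z'], and move it to a point of [F x] at distance at most
    [l * rho x z].  The detour from [x] to [z] to [z'] costs at most
    [l * (rho x z + rho x z + rho x z')], hence at most [3 * l * rho x z'],
    which is where [3 * l <= k] comes from.

    For the Hausdorff distance, a point [a] of [F2 x] has to be approximated in
    [F2 y].  Helly's theorem on [F y] reduces this to approximating [a] in [F y]
    while staying within [k * rho y z] of a single set [F1 z].  Choose [w] in
    [F1 z] close to [a]; the definition of [F1] provides a point [q] of [F y]
    within [l * rho y z] of [w], deep inside the ball of radius [k * rho y z],
    and [a] is within [k * rho x y] of some [c] in [F y].  Moving from [c]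
    towards [q] until the ball is entered costs [kappa] times the excess of the
    distance from [c] to [w], and this excess is at most [2 * k * rho x y].
    This gives [gamma = k * (1 + 2 * kappa)].  By the triangle inequality
    [kappa = (k + l) / (k - l)] works in every normed space
    ([normed_retraction_bound]); when the norm comes from an inner product,
    plane geometry improves it to [k / sqrt (k ^ 2 - l ^ 2)]
    ([euclidean_retraction_bound]). *)

(** * Helly's theorem for sets of dimension at most one *)

(** Convexity with a bare real parameter; [convex_set] asks for a parameter
    carrying its bounds in its type. *)
Definition segment_closed (R : realType) (X : lmodType R) (S : set X) : Prop :=
  forall x y (t : R), S x -> S y -> 0 <= t <= 1 -> S (x + t *: (y - x)).

Lemma convex_set_segment_closed (R : realType) (X : lmodType R) (S : set X) :
  convex_set (S : set (convex_lmodType X)) -> segment_closed S.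
Proof.
move=> cS x y t Sx Sy /andP[t0 t1].
have i01 : Itv.spec (Itv.num_sem (R := R))
    (Itv.Real (Interval (BSide true 0%Z) (BSide false 1%Z))) t.
  by rewrite /= /Itv.num_sem /= in_itv /= num_real t0 t1.
have := cS y x (Itv.Def i01) (mem_set Sy) (mem_set Sx); rewrite inE.
rewrite [conv _ _ _](_ : _ = x + t *: (y - x))//.
by rewrite /conv /= scalerBl scale1r scalerBr addrCA.
Qed.

Lemma segment_closed_convex_set (R : realType) (X : lmodType R) (S : set X) :
  segment_closed S -> convex_set (S : set (convex_lmodType X)).
Proof.
move=> cS y x t; rewrite !inE => Sy Sx.
rewrite [conv _ _ _](_ : _ = x + t%:num *: (y - x)).
  by apply: cS => //; rewrite ge0 le1.
by rewrite /conv /= scalerBl scale1r scalerBr addrCA.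
Qed.

(** Compactness provides each [J i] with a least and a greatest element.  As the
    sets meet pairwise, no least element exceeds a greatest one, so the supremum
    of the least elements lies between the endpoints of each [J i]. *)
Lemma helly_interval (R : realType) (I : Type) (i0 : I) (J : I -> set R) :
  (forall i, compact (J i)) -> (forall i, is_interval (J i)) ->
  (forall i j, J i `&` J j !=set0) -> exists t, forall i, J i t.
Proof.
move=> cJ iJ pJ.
have J0 i : J i !=set0 by have [t [? _]] := pJ i i; exists t.
have idJ i : {within J i, continuous (id : R -> R)}.
  by apply: continuous_subspaceT => ?.
have /choice[a aJ] i : exists a, J i a /\ forall t, J i t -> a <= t.
  have [a] := compact_EVT_min (J0 i) (cJ i) (idJ i); rewrite inE => Ja aP.
  by exists a; split=> // t Jt; apply: aP; rewrite inE.
have /choice[b bJ] i : exists b, J i b /\ forall t, J i t -> t <= b.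
  have [b] := compact_EVT_max (J0 i) (cJ i) (idJ i); rewrite inE => Jb bP.
  by exists b; split=> // t Jt; apply: bP; rewrite inE.
have ab i j : a i <= b j.
  have [t [Ji Jj]] := pJ i j.
  exact: le_trans ((aJ i).2 _ Ji) ((bJ j).2 _ Jj).
exists (sup (range a)) => i.
apply: (iJ i _ _ (aJ i).1 (bJ i).1); apply/andP; split.
  apply: ub_le_sup; last by exists i.
  by exists (b i) => _ [j _ <-].
apply: ge_sup; first by exists (a i0), i0.
by move=> _ [j _ <-].
Qed.

Lemma K1_segment_closed (R : realType) (X : normedModType R) (C : set X) :
  K1 X C -> segment_closed C.
Proof. by case=> _ /convex_set_segment_closed. Qed.

Lemma K1_compact (R : realType) (X : normedModType R) (C : set X) :
  K1 X C -> compact C.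
Proof. by case. Qed.

Lemma segment_closedI (R : realType) (X : lmodType R) (S T : set X) :
  segment_closed S -> segment_closed T -> segment_closed (S `&` T).
Proof.
by move=> cS cT x y t [Sx Tx] [Sy Ty] t01; split; [exact: cS|exact: cT].
Qed.

Lemma K1I_closed (R : realType) (X : normedModType R) (C S : set X) :
  K1 X C -> closed S -> segment_closed S -> C `&` S !=set0 ->
  K1 X (C `&` S).
Proof.
move=> KC clS cvS CS0; have [_ _ cC [p [v Cpv]]] := KC; split=> //.
- apply: segment_closed_convex_set; apply: segment_closedI => //.
  exact: K1_segment_closed.
- exact: compact_closedI.
- by exists p, v => x [/Cpv].
Qed.

(** The sets [C `&` S i] pull back along an affine parametrization of a line
    containing [C] to compact intervals.  A direction [v = 0] has to be set
    apart, since the pullbacks are then unbounded. *)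
Lemma helly_K1 (R : realType) (X : normedModType R) (C : set X) (I : Type)
    (S : I -> set X) :
  K1 X C -> (forall i, closed (S i)) -> (forall i, segment_closed (S i)) ->
  (forall i j, exists x, [/\ C x, S i x & S j x]) ->
  exists2 x, C x & forall i, S i x.
Proof.
move=> KC clS cvS pS; have [[c0 Cc0] _ Cc [p [v Cpv]]] := KC.
have [[i0]|I0] := pselect (exists i : I, True); last first.
  by exists c0 => // i; case: I0; exists i.
have [v0|v0] := eqVneq v 0.
  have Cp x : C x -> x = p by move=> /Cpv[t _ <-]; rewrite v0 scaler0 addr0.
  exists c0 => // i; have [x [Cx Sx _]] := pS i i.
  by rewrite (Cp _ Cc0) -(Cp _ Cx).
pose g (t : R) := p + t *: v.
have g_cont : continuous g.
  move=> t; apply: cvgD; first exact: cvg_cst.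
  by apply: cvgZr_tmp; exact: cvg_id.
pose J i := g @^-1` (C `&` S i).
have Cclosed : closed C := compact_closed (@norm_hausdorff _ _) Cc.
(* [T] bounds the parameters of the points of [C]. *)
have [N0 [_ CN0]] := compact_bounded Cc.
have [N CN] : exists N, forall x, C x -> `|x| <= N.
  by exists (N0 + 1) => x Cx; apply: (CN0 (N0 + 1)) => //; rewrite ltrDl.
pose T := (N + `|p|) / `|v|.
have JT i : J i `<=` `[- T, T].
  move=> t [Ct _]; rewrite /= in_itv /= -ler_norml /T ler_pdivlMr ?normr_gt0//.
  rewrite -normrZ -[_ *: _](addKr p) addrC.
  by apply: le_trans (ler_normB _ _) _; rewrite lerD2r; exact: CN.
have cJ i : compact (J i).
  apply: (subclosed_compact _ (@segment_compact R (- T) T) (JT i)).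
  by apply: preimage_closed; [move=> ? _; exact: g_cont|exact: closedI].
have iJ i : is_interval (J i).
  move=> s u Js Ju z /andP[sz zu].
  have [su|su] := eqVneq s u.
    by have -> : z = s by apply/le_anti; rewrite sz su zu.
  have su0 : 0 < u - s by rewrite subr_gt0 lt_neqAle su (le_trans sz).
  pose r := (z - s) / (u - s).
  have gz : g z = g s + r *: (g u - g s).
    have rE : z = s + r * (u - s) by rewrite /r divfK ?gt_eqF// addrC subrK.
    rewrite {1}rE /g opprD addrACA subrr add0r -scalerBl scalerA -addrA.
    by rewrite -scalerDl.
  rewrite /J /preimage /= gz.
  apply: (segment_closedI (K1_segment_closed KC) (cvS i)) => //.
  rewrite /r divr_ge0 ?subr_ge0// ?(le_trans sz)//=.
  by rewrite ler_pdivrMr// mul1r lerD2r.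
have [|t tJ] := helly_interval i0 cJ iJ.
  move=> i j; have [x [Cx Si Sj]] := pS i j.
  by have [t _ gt] := Cpv _ Cx; exists t; rewrite /J /preimage /g /= gt.
by exists (g t) => [|i]; [case: (tJ i0)|case: (tJ i)].
Qed.

(** * Metric neighbourhoods of compact convex sets *)

(** Turns membership in a Minkowski sum into a distance estimate, uniformly in
    finite and infinite radii. *)
Lemma nbhdP (R : realType) (X : normedModType R) (A : set X) (e : \bar R)
    (y : X) :
  minkowski_sum A (cball0 X e) y <-> exists2 a, A a & (`|y - a|%:E <= e)%E.
Proof.
split=> [[a Aa [b be <-]]|[a Aa ya]].
  by exists a => //; rewrite addrAC subrr add0r.
by exists a => //; exists (y - a) => //; rewrite addrC subrK.
Qed.

(** A point whose distance to every point of [A] exceeds [e] has, as [A] is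
    compact, its minimal distance to [A] above [e], and then so has a whole
    ball around it. *)
Lemma nbhd_closed (R : realType) (X : normedModType R) (A : set X)
    (e : \bar R) :
  compact A -> closed (minkowski_sum A (cball0 X e)).
Proof.
move=> cA y cly.
have [a [Aa _]] : exists a, A a /\ True.
  by have [z [/nbhdP[a Aa _] _]] := cly _ (filterT); exists a.
have dist_cont : {within A, continuous (fun a => `|y - a|)}.
  apply: continuous_subspaceT => z; apply: cvg_norm.
  by apply: cvgB; [exact: cvg_cst|exact: cvg_id].
have [b Ab bmin] := compact_EVT_min (ex_intro _ a Aa) cA dist_cont.
move: Ab; rewrite inE => Ab; apply/nbhdP; exists b => //.
rewrite leNgt; apply/negP => eb.
case: e cly eb => [r| |] cly eb; last 2 first.
- by [].
- by have [z [/nbhdP[? _]]] := cly _ (filterT); rewrite leNgt ltNyr.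
rewrite lte_fin in eb.
have d0 : 0 < `|y - b| - r by rewrite subr_gt0.
have [z [/nbhdP[c Ac zc] yz]] := cly _ (nbhsx_ballx y _ d0).
rewrite lee_fin in zc; move: yz; rewrite -ball_normE /= => yz.
have := bmin c (mem_set Ac); rewrite leNgt => /negP; apply.
have -> : y - c = (y - z) + (z - c) by rewrite addrA subrK.
apply: le_lt_trans (ler_normD _ _) _; lra.
Qed.

Lemma nbhd_segment_closed (R : realType) (X : normedModType R) (A : set X)
    (e : \bar R) :
  segment_closed A -> segment_closed (minkowski_sum A (cball0 X e)).
Proof.
move=> cA x y t /nbhdP[a Aa xa] /nbhdP[b Ab yb] /[dup] t01 /andP[t0 t1].
apply/nbhdP; exists (a + t *: (b - a)); first exact: cA.
case: e xa yb => [r| |] xa yb; rewrite ?leey//.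
rewrite !lee_fin in xa yb *.
have -> : x + t *: (y - x) - (a + t *: (b - a)) =
          (1 - t) *: (x - a) + t *: (y - b).
  rewrite opprD addrACA -scalerBr scalerBl scale1r -[RHS]addrA; congr (_ + _).
  by rewrite [RHS]addrC -scalerBr; congr (_ *: _); rewrite !opprD addrACA.
apply: le_trans (ler_normD _ _) _.
rewrite !normrZ (ger0_norm t0) ger0_norm ?subr_ge0//.
nra.
Qed.

(** * Moving a point towards a ball *)

(** The price of entering a ball along a segment whose far end lies well inside
    it, relative to the distance to the ball: without the smaller concentric
    ball around the far end, a segment nearly tangent to the ball would admit
    no such bound. *)
Definition retraction_bound (R : realType) (X : normedModType R)
    (l k kappa : R) : Prop :=
  forall (o q c : X) (r : R), 0 <= r -> `|q - o| <= l * r ->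
    k * r < `|c - o| ->
  exists t, [/\ 0 <= t <= 1, `|c + t *: (q - c) - o| <= k * r &
    `|t *: (q - c)| <= kappa * (`|c - o| - k * r)].

Lemma segment_pointE (R : realType) (X : lmodType R) (o q c : X) (t : R) :
  c + t *: (q - c) - o = (1 - t) *: (c - o) + t *: (q - o).
Proof.
rewrite addrAC scalerBl scale1r -[RHS]addrA; congr (_ + _).
by rewrite [RHS]addrC -scalerBr opprB addrA subrK.
Qed.

(** With [P] the distance from [c] to [o], the distance to [o] is convex along
    the segment, at most [P] at [c] and [l * r] at [q], so it has dropped to
    [k * r] at the parameter [t = (P - k * r) / (P - l * r)]; the segment has
    length at most [P + l * r], and [(P + l * r) / (P - l * r)] decreases in
    [P]. *)
Lemma normed_retraction_bound (R : realType) (X : normedModType R) (l k : R) :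
  0 < l -> l < k -> retraction_bound X l k ((k + l) / (k - l)).
Proof.
move=> l0 lk o q c r r0 qo co.
set P := `|c - o|; rewrite -/P in co.
have lkr : l * r <= k * r by rewrite ler_wpM2r// ltW.
have Pr : 0 < P - l * r by rewrite subr_gt0 (le_lt_trans lkr).
have kl : 0 < k - l by rewrite subr_gt0.
pose t := (P - k * r) / (P - l * r).
have t0 : 0 <= t by rewrite divr_ge0 ?ltW// subr_gt0.
have t1 : t <= 1 by rewrite ler_pdivrMr// mul1r lerD2l lerN2.
have tE : t * (P - l * r) = P - k * r by rewrite /t divfK ?gt_eqF.
clearbody t.
exists t; split; first by rewrite t0.
  rewrite segment_pointE; apply: le_trans (ler_normD _ _) _.
  rewrite !normrZ (ger0_norm t0) ger0_norm ?subr_ge0// -/P.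
  have : t * `|q - o| <= t * (l * r) by rewrite ler_wpM2l.
  lra.
have qc : `|q - c| <= l * r + P.
  rewrite -[q - c](subrKA o); apply: le_trans (ler_normD _ _) _.
  by rewrite (distrC o) lerD2r.
rewrite normrZ (ger0_norm t0).
apply: (@le_trans _ _ (t * (l * r + P))); first by rewrite ler_wpM2l.
rewrite mulrAC ler_pdivlMr// -tE -mulrA [leRHS]mulrCA ler_wpM2l//.
have : l * (k * r) <= l * P by rewrite ler_pM2l// ltW.
lra.
Qed.

(** Stewart's theorem. *)
Lemma euclidean_norm_segment (R : realType) (X : normedModType R) (a b : X)
    (t : R) :
  euclidean X ->
  `|(1 - t) *: a + t *: b| ^+ 2 =
  (1 - t) * `|a| ^+ 2 + t * `|b| ^+ 2 - t * (1 - t) * `|b - a| ^+ 2.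
Proof.
move=> [ip ipE]; rewrite !ipE.
have ipC x y : ip x y = ip y x by rewrite hermC /= expr0 mul1r.
have ipDl x y z : ip (x + y) z = ip x z + ip y z by exact: linearDl.
have ipZl s x z : ip (s *: x) z = s * ip x z by exact: linearZl_LR.
have ipDr x y z : ip z (x + y) = ip z x + ip z y by rewrite ipC ipDl !(ipC z).
have ipZr s x z : ip z (s *: x) = s * ip z x by rewrite ipC ipZl (ipC z).
rewrite -[- a]scaleN1r !(ipDl, ipDr, ipZl, ipZr) (ipC b a); ring.
Qed.

(** The worst line through [c] is tangent to the inner ball.  On it, with [P]
    the distance from [c] to [o], the point [c] and the entry point into the
    outer ball are at distances [m = sqrt (P ^ 2 - (l * r) ^ 2)] and
    [n = sqrt ((k * r) ^ 2 - (l * r) ^ 2)] from the point of tangency.  So after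
    a path of length [m - n] any segment ending in the inner ball has entered
    the outer one, or has already ended. *)
Lemma euclidean_retraction_bound (R : realType) (X : normedModType R)
    (l k : R) :
  0 < l -> l < k -> euclidean X ->
  retraction_bound X l k (k / Num.sqrt (k ^+ 2 - l ^+ 2)).
Proof.
move=> l0 lk eX o q c r r0 qo co.
set P := `|c - o|; rewrite -/P in co.
set D := Num.sqrt _; set W := `|q - c|.
have k0 : 0 < k := lt_trans l0 lk.
have kr0 : 0 <= k * r by rewrite mulr_ge0// ltW.
have lr0 : 0 <= l * r by rewrite mulr_ge0// ltW.
have lkr : l * r <= k * r by rewrite ler_wpM2r// ltW.
have P0 : 0 < P := le_lt_trans kr0 co.
have kl2 : 0 < k ^+ 2 - l ^+ 2 by rewrite subr_gt0 ltr_pXn2r ?nnegrE// ltW.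
have D0 : 0 < D by rewrite sqrtr_gt0.
have D2 : D ^+ 2 = k ^+ 2 - l ^+ 2 by rewrite sqr_sqrtr// ltW.
pose n := D * r.
have n0 : 0 <= n by rewrite mulr_ge0// ltW.
have n2 : n ^+ 2 = (k * r) ^+ 2 - (l * r) ^+ 2.
  by rewrite exprMn D2 mulrBl !exprMn.
pose m := Num.sqrt (P ^+ 2 - (l * r) ^+ 2).
have m2 : m ^+ 2 = P ^+ 2 - (l * r) ^+ 2.
  rewrite sqr_sqrtr// subr_ge0 ler_pXn2r ?nnegrE ?(ltW P0)//.
  exact: ltW (le_lt_trans lkr co).
have m0 : 0 <= m := sqrtr_ge0 _.
have kP : (k * r) ^+ 2 <= P ^+ 2 by rewrite ler_pXn2r ?nnegrE// ltW.
have nm : n <= m by rewrite -(@ler_pXn2r _ 2) ?nnegrE// n2 m2 lerD2r.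
have DPkm : D * P <= k * m.
  rewrite -(@ler_pXn2r _ 2) ?nnegrE ?mulr_ge0 ?(ltW D0) ?(ltW P0) ?(ltW k0)//.
  rewrite !exprMn D2 m2.
  have := ler_wpM2l (sqr_ge0 l) kP; rewrite !exprMn; lra.
have DPr : D * (k * r) = k * n by rewrite /n mulrCA.
(* [m - n = (P ^ 2 - (k * r) ^ 2) / (m + n)], and [m + n] is bounded below by
   [DPkm] and [DPr]. *)
have mn_le : m - n <= k / D * (P - k * r).
  rewrite mulrAC ler_pdivlMr//.
  have mP : 0 < m + n.
    apply: ltr_wpDr => //.
    by rewrite -(pmulr_rgt0 _ k0) (lt_le_trans _ DPkm)// mulr_gt0.
  rewrite -(ler_pM2r mP).
  have -> : (m - n) * D * (m + n) = D * (P - k * r) * (P + k * r).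
    transitivity ((m ^+ 2 - n ^+ 2) * D); first ring.
    by rewrite m2 n2; ring.
  rewrite [leLHS]mulrAC [leRHS]mulrAC ler_wpM2r ?subr_ge0 ?(ltW co)//.
  by rewrite !mulrDr DPr lerD2r.
have [Wmn|Wmn] := leP W (m - n).
  exists 1; rewrite ler01 lexx scale1r [c + _]addrC subrK; split => //.
    exact: le_trans qo lkr.
  exact: le_trans Wmn mn_le.
have W0 : 0 < W by apply: le_lt_trans Wmn; rewrite subr_ge0.
pose t := (m - n) / W.
have t0 : 0 <= t by rewrite divr_ge0 ?subr_ge0// ltW.
have t1 : t <= 1 by rewrite ler_pdivrMr// mul1r ltW.
have tW : t * W = m - n by rewrite /t divfK ?gt_eqF.
clearbody t.
exists t; split; first by rewrite t0.
  rewrite -(@ler_pXn2r _ 2) ?nnegrE//.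
  rewrite segment_pointE euclidean_norm_segment//.
  rewrite (_ : q - o - (c - o) = q - c); last by rewrite opprB addrA subrK.
  rewrite -/P -/W.
  have q2 : t * `|q - o| ^+ 2 <= t * (l * r) ^+ 2.
    by rewrite ler_wpM2l// ler_pXn2r ?nnegrE.
  (* Comparing [m ^ 2 + W ^ 2] with [2 * m * W] says that, for a given distance
     [P], the tangent length [W = m] is the worst case. *)
  have amgm : 0 <= t * (m - W) ^+ 2 by rewrite mulr_ge0// sqr_ge0.
  have -> : t * (1 - t) * W ^+ 2 = t * W ^+ 2 - (t * W) ^+ 2 by ring.
  have mW : t * (m - W) ^+ 2 = t * m ^+ 2 - 2 * m * (t * W) + t * W ^+ 2.
    by ring.
  rewrite mW m2 in amgm; rewrite tW in amgm *.
  lra.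
by rewrite normrZ (ger0_norm t0) tW.
Qed.

(** * Selections on four points *)

(** The points may coincide, so that the same statement also serves selections
    on fewer than four points. *)
Lemma four_points_card (M : Type) (a b c d : M) :
  ([set x | [\/ x = a, x = b, x = c | x = d]] #<= `I_4)%card.
Proof.
pose f (i : nat) := nth a [:: a; b; c; d] i.
rewrite (_ : [set x | _] = f @` `I_4); first exact: card_image_le.
apply/seteqP; split=> [x [->|->|->|->]|_ [i i4 <-]] /=.
- by exists 0%N.
- by exists 1%N.
- by exists 2%N.
- by exists 3%N.
- move: i i4 => [|[|[|[|//]]]] _; rewrite /f /=.
  + exact: Or41.
  + exact: Or42.
  + exact: Or43.
  + exact: Or44.
Qed.

(** The infimum in the seminorm need not be attained; the constant [1] is
    nevertheless admissible, being a limit of admissible ones. *)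
Lemma lip_seminorm_le1 (R : realType) (M : Type) (rho : M -> M -> \bar R)
    (X : normedModType R) (M' : set M) (f : M -> X) (x y : M) :
  is_pseudometric rho -> (lip_seminorm rho M' f <= 1)%E -> M' x -> M' y ->
  (`|f x - f y|%:E <= rho x y)%E.
Proof.
move=> hrho lipf Mx My; have := pseudometric_ge0 hrho x y.
case rxy: (rho x y) => [r| |]; rewrite ?leey// lee_fin => r0.
apply/lee_addgt0Pr => e e0.
have r1 : 0 < r + 1 by rewrite ltr_wpDl.
have e1 : 0 < e / (r + 1) by rewrite divr_gt0.
have /ereal_inf_lt[_ [l [l0 lf] <-]] :
    (lip_seminorm rho M' f < (1 + e / (r + 1))%:E)%E.
  by apply: le_lt_trans lipf _; rewrite lte_fin ltrDl.
rewrite lte_fin => le1; apply: le_trans (lf x y Mx My) _.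
rewrite rxy -EFinM -EFinD lee_fin.
apply: (@le_trans _ _ ((1 + e / (r + 1)) * r)).
  by rewrite ler_wpM2r// ltW.
rewrite mulrDl mul1r lerD2l mulrAC ler_pdivrMr//.
by rewrite ler_wpM2l ?(ltW e0)// lerDl.
Qed.

(** * The refinements of a set-valued mapping *)

Lemma within_trans (R : realType) (X : normedModType R) (x y z : X)
    (e1 e2 : \bar R) :
  (`|x - y|%:E <= e1)%E -> (`|y - z|%:E <= e2)%E ->
  (`|x - z|%:E <= e1 + e2)%E.
Proof.
move=> xy yz; apply: le_trans (leeD xy yz).
by rewrite -EFinD lee_fin -{1}[x](subrK y) -addrA ler_normD.
Qed.

Lemma within_sym (R : realType) (X : normedModType R) (x y : X) (e : \bar R) :
  (`|x - y|%:E <= e)%E -> (`|y - x|%:E <= e)%E.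
Proof. by rewrite distrC. Qed.

Section Refinement.
Context {R : realType} {M : Type} {X : normedModType R}.
Variables (rho : M -> M -> \bar R) (hrho : is_pseudometric rho).

Let rho_ge0 x y : (0 <= rho x y)%E := pseudometric_ge0 hrho x y.
Let rhoC x y : rho x y = rho y x := pseudometric_sym hrho x y.

Lemma refinementP (l : R) (G : M -> set X) (x : M) (a : X) :
  metric_refinement rho l G x a <->
  forall z, exists2 b, G z b & (`|a - b|%:E <= l%:E * rho x z)%E.
Proof.
split=> [Ga z|Ga z _]; first by apply/nbhdP; exact: Ga.
by apply/nbhdP; exact: Ga.
Qed.

Lemma refinement_sub (l : R) (G : M -> set X) (x : M) :
  metric_refinement rho l G x `<=` G x.
Proof.
move=> a /refinementP/(_ x)[b Gb]; rewrite (pseudometric_refl hrho) mule0.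
by rewrite lee_fin normr_le0 subr_eq0 => /eqP ->.
Qed.

Lemma refinement_closed (l : R) (G : M -> set X) (x : M) :
  (forall z, compact (G z)) -> closed (metric_refinement rho l G x).
Proof. by move=> cG; apply: closed_bigI => z _; exact: nbhd_closed. Qed.

Lemma refinement_compact (l : R) (G : M -> set X) (x : M) :
  (forall z, compact (G z)) -> compact (metric_refinement rho l G x).
Proof.
move=> cG; apply: (subclosed_compact _ (cG x)); first exact: refinement_closed.
exact: refinement_sub.
Qed.

Lemma refinement_segment_closed (l : R) (G : M -> set X) (x : M) :
  (forall z, segment_closed (G z)) ->
  segment_closed (metric_refinement rho l G x).
Proof.
move=> cG y z t Gy Gz t01 w _.
by apply: nbhd_segment_closed => //; [exact: Gy|exact: Gz].
Qed.

Variables (F : M -> set X) (hF : forall x, K1 X (F x)).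
Hypothesis hsel : forall M' : set M, (M' #<= `I_4)%card ->
  exists f : M -> X,
    selection_on F M' f /\ (lip_seminorm rho M' f <= 1)%E.

Variables (l k : R).
Hypotheses (l1 : 1 <= l) (lk : 3 * l <= k).

Let l0 : 0 < l. Proof. exact: lt_le_trans ltr01 l1. Qed.
Let k0 : 0 < k. Proof. by rewrite (lt_le_trans _ lk)// mulr_gt0. Qed.

Local Notation F1 := (metric_refinement rho l F).
Local Notation F2 := (metric_refinement rho k F1).

Lemma four_point_selection (a b c d : M) :
  exists f : M -> X,
    [/\ F a (f a), F b (f b), F c (f c), F d (f d) &
      forall x y, [\/ x = a, x = b, x = c | x = d] ->
        [\/ y = a, y = b, y = c | y = d] ->
      (`|f x - f y|%:E <= l%:E * rho x y)%E].
Proof.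
have [f [sf lipf]] := hsel (four_points_card a b c d).
exists f; split.
- by apply: sf; exact: Or41.
- by apply: sf; exact: Or42.
- by apply: sf; exact: Or43.
- by apply: sf; exact: Or44.
move=> x y xM yM; apply: le_trans (lip_seminorm_le1 hrho lipf xM yM) _.
by rewrite lee_pemull// lee_fin.
Qed.

(** Helly's theorem on [F x]: two conditions and the base point make three
    points of [M]. *)
Lemma first_refinement_nonempty x : F1 x !=set0.
Proof.
have [||i j|a Fa F1a] := helly_K1 (I := M)
    (S := fun z => minkowski_sum (F z) (cball0 X (l%:E * rho x z)%E)) (hF x).
- by move=> z; apply: nbhd_closed; exact: K1_compact.
- by move=> z; apply: nbhd_segment_closed; exact: K1_segment_closed.
- have [f [Fx Fi Fj _ lipf]] := four_point_selection x i j j.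
  exists (f x); split=> //; apply/nbhdP.
    by exists (f i) => //; apply: lipf; [exact: Or41|exact: Or42].
  by exists (f j) => //; apply: lipf; [exact: Or41|exact: Or43].
- by exists a => z _; exact: F1a.
Qed.

Lemma first_refinement_compact x : compact (F1 x).
Proof. by apply: refinement_compact => z; exact: K1_compact. Qed.

Lemma first_refinement_segment_closed x : segment_closed (F1 x).
Proof. by apply: refinement_segment_closed => z; exact: K1_segment_closed. Qed.

(** Keeping only the condition at [u] on the side of [z] leaves, in Helly's
    theorem on [F z'], pairs of conditions that involve at most the four points
    [z], [u], [z'] and [w]. *)
Lemma first_refinement_close_neighbour z z' (u : M) :
  exists a b, [/\ F z a, F1 z' b, (`|a - b|%:E <= l%:E * rho z z')%E &
    exists2 c, F u c & (`|a - c|%:E <= l%:E * rho z u)%E].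
Proof.
pose A := F z `&` minkowski_sum (F u) (cball0 X (l%:E * rho z u)%E).
have KA : K1 X A.
  apply: K1I_closed => //.
  - by apply: nbhd_closed; exact: K1_compact.
  - by apply: nbhd_segment_closed; exact: K1_segment_closed.
  have [f [Fz Fu _ _ lipf]] := four_point_selection z u u u.
  exists (f z); split=> //; apply/nbhdP.
  by exists (f u) => //; apply: lipf; [exact: Or41|exact: Or42].
pose S (o : option M) := match o with
  | None => minkowski_sum A (cball0 X (l%:E * rho z z')%E)
  | Some w => minkowski_sum (F w) (cball0 X (l%:E * rho z' w)%E) end.
have [|||b Fb Sb] := helly_K1 (S := S) (hF z').
- by case=> [w|]; apply: nbhd_closed; exact: K1_compact.
- by case=> [w|]; apply: nbhd_segment_closed; exact: K1_segment_closed.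
- have SA (f : M -> X) : F z (f z) -> F u (f u) ->
      (`|f z - f u|%:E <= l%:E * rho z u)%E ->
      (`|f z' - f z|%:E <= l%:E * rho z z')%E -> S None (f z').
    move=> Fz Fu zu z'z; apply/nbhdP; exists (f z) => //; split=> //.
    by apply/nbhdP; exists (f u).
  have SN w : exists x, [/\ F z' x, S (Some w) x & S None x].
    have [f [Fz' Fw Fz Fu lipf]] := four_point_selection z' w z u.
    exists (f z'); split=> //.
      apply/nbhdP; exists (f w) => //.
      by apply: lipf; [exact: Or41|exact: Or42].
    apply: SA => //; first by apply: lipf; [exact: Or43|exact: Or44].
    by rewrite distrC; apply: lipf; [exact: Or43|exact: Or41].
  move=> [w|] [w'|] //.
  + have [f [Fz' Fw Fw' _ lipf]] := four_point_selection z' w w' w'.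
    exists (f z'); split=> //; apply/nbhdP.
      by exists (f w) => //; apply: lipf; [exact: Or41|exact: Or42].
    by exists (f w') => //; apply: lipf; [exact: Or41|exact: Or43].
  + by have [x [? ? ?]] := SN w'; exists x.
  + by have [x [? ? ?]] := SN z; exists x.
have /nbhdP[a [Fa /nbhdP[c Fc ac]] ba] := Sb None.
exists a, b; split=> //; last by exists c.
- by apply/refinementP => w; apply/nbhdP; exact: (Sb (Some w)).
- exact: within_sym.
Qed.

(** Helly's theorem on [F z]: by [first_refinement_close_neighbour] each
    condition defining [F1 z] is compatible with closeness to [F1 z']. *)
Lemma first_refinements_close z z' :
  exists a b, [/\ F1 z a, F1 z' b & (`|a - b|%:E <= l%:E * rho z z')%E].
Proof.
pose S (o : option M) := match o with
  | None => minkowski_sum (F1 z') (cball0 X (l%:E * rho z z')%E)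
  | Some w => minkowski_sum (F w) (cball0 X (l%:E * rho z w)%E) end.
have [|||a Fa Sa] := helly_K1 (S := S) (hF z).
- case=> [w|]; apply: nbhd_closed; first exact: K1_compact.
  exact: first_refinement_compact.
- case=> [w|]; apply: nbhd_segment_closed; first exact: K1_segment_closed.
  exact: first_refinement_segment_closed.
- have SN w : exists x, [/\ F z x, S (Some w) x & S None x].
    have [a [b [Fa Fb ab [c Fc ac]]]] :=
      first_refinement_close_neighbour z z' w.
    by exists a; split=> //; apply/nbhdP; [exists c|exists b].
  move=> [w|] [w'|] //.
  + have [a F1a] := first_refinement_nonempty z.
    exists a; split; first exact: refinement_sub F1a.
      by apply/nbhdP; move/refinementP: F1a; exact.
    by apply/nbhdP; move/refinementP: F1a; exact.
  + by have [x [? ? ?]] := SN w'; exists x.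
  + by have [x [? ? ?]] := SN z; exists x.
have /nbhdP[b Fb ab] := Sa None.
exists a, b; split=> //.
by apply/refinementP => w; apply/nbhdP; exact: (Sa (Some w)).
Qed.

(** The detour through the nearer point [z] costs at most three times the
    direct distance from [x] to [z']. *)
Lemma radius_detour x z z' : (rho x z <= rho x z')%E ->
  (l%:E * rho x z + l%:E * rho z z' <= k%:E * rho x z')%E.
Proof.
move=> xzz'; have := pseudometric_triangle hrho z z' x; rewrite (rhoC z x).
move: (rho_ge0 x z) (rho_ge0 x z') (rho_ge0 z z') xzz'.
case: (rho x z') => [s| |] // ; last first.
  by move=> _ _ _ _ _; rewrite gt0_muley ?lte_fin ?leey.
case: (rho x z) => [r| |] //; case: (rho z z') => [q| |] //.
rewrite -!EFinM -!EFinD !lee_fin => r0 s0 q0 rs qrs.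
have h1 : l * q <= l * (r + s) by rewrite ler_pM2l.
have h2 : l * r <= l * s by rewrite ler_pM2l.
have h3 : 3 * l * s <= k * s by rewrite ler_wpM2r.
lra.
Qed.

Lemma second_refinement_conditions_meet x z z' : exists c,
  [/\ F x c, minkowski_sum (F1 z) (cball0 X (k%:E * rho x z)%E) c &
    minkowski_sum (F1 z') (cball0 X (k%:E * rho x z')%E) c].
Proof.
wlog zz' : z z' / (rho x z <= rho x z')%E.
  move=> W; have [/W//|/ltW/W[c [? ? ?]]] := leP (rho x z) (rho x z').
  by exists c.
have [a [b [F1a F1b ab]]] := first_refinements_close z z'.
have /refinementP/(_ x)[c Fc] := F1a; rewrite rhoC => /within_sym ca.
exists c; split=> //; apply/nbhdP.
  exists a => //; apply: le_trans ca _; apply: lee_wpmul2r => //.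
  rewrite lee_fin; move: l0 lk; lra.
exists b => //; apply: le_trans (within_trans ca ab) _.
exact: radius_detour.
Qed.

Lemma second_refinement_nonempty x : F2 x !=set0.
Proof.
have [|||c Fc F2c] := helly_K1 (I := M)
    (S := fun z => minkowski_sum (F1 z) (cball0 X (k%:E * rho x z)%E)) (hF x).
- by move=> z; apply: nbhd_closed; exact: first_refinement_compact.
- move=> z; apply: nbhd_segment_closed.
  exact: first_refinement_segment_closed.
- exact: second_refinement_conditions_meet.
- by exists c => z _; exact: F2c.
Qed.

Variables (kappa gamma : R).
Hypotheses (kappa0 : 0 <= kappa) (kappaP : retraction_bound X l k kappa).
Hypothesis gammaP : k * (1 + 2 * kappa) <= gamma.

Let kgamma : k <= gamma.
Proof.
by apply: le_trans gammaP; rewrite ler_peMr ?(ltW k0)// lerDl mulr_ge0.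
Qed.

Let gamma0 : 0 < gamma. Proof. exact: lt_le_trans kgamma. Qed.

(** The estimate with a single condition on the approximating point: [w] is the
    point of [F1 z] near [a], [q] a point of [F y] deep inside the ball around
    [w], and [c1] a point of [F y] near [a], which is moved towards [q]. *)
Lemma second_refinement_approx x y z a : F2 x a -> exists c,
  [/\ F y c, minkowski_sum (F1 z) (cball0 X (k%:E * rho y z)%E) c &
    (`|c - a|%:E <= gamma%:E * rho x y)%E].
Proof.
move=> /refinementP F2a.
have [w F1w aw] := F2a z.
have [c1 F1c1 ac1] := F2a y.
have Fc1 := refinement_sub F1c1.
have /refinementP/(_ y)[q Fq wq] := F1w.
have l_le_k : l <= k by move: l0 lk; lra.
have := rho_ge0 x y; case sE: (rho x y) => [s| |] //; last first.
  move=> _; exists q; split=> //; last by rewrite gt0_muley ?lte_fin ?leey.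
  apply/nbhdP; exists w => //; apply: le_trans (within_sym wq) _.
  by rewrite rhoC; apply: lee_wpmul2r => //; rewrite lee_fin.
rewrite lee_fin => s0; rewrite sE -EFinM lee_fin in ac1.
have [c1w|] := leP (`|c1 - w|%:E) (k%:E * rho y z)%E.
  exists c1; split=> //; first by apply/nbhdP; exists w.
  rewrite -EFinM lee_fin distrC (le_trans ac1)//.
  by rewrite ler_wpM2r.
have := rho_ge0 y z; have := pseudometric_triangle hrho x z y; rewrite sE.
move: wq aw; rewrite (rhoC z y).
case rE: (rho y z) => [r| |] //; last first.
  by move=> _ _ _ _; rewrite gt0_muley ?lte_fin// ltNge leey.
have := rho_ge0 x z; case uE: (rho x z) => [u| |] // _.
rewrite -!EFinM -EFinD !lee_fin lte_fin => wq aw usr r0 c1w.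
have qw : `|q - w| <= l * r by rewrite distrC.
have [t [t01 co ct]] := kappaP r0 qw c1w.
exists (c1 + t *: (q - c1)); split.
- exact: K1_segment_closed.
- by apply/nbhdP; exists w => //; rewrite -EFinM lee_fin.
rewrite lee_fin addrAC; apply: le_trans (ler_normD _ _) _.
have ku : k * u <= k * (s + r) by rewrite ler_pM2l.
have c1w_le : `|c1 - w| <= k * s + k * u.
  rewrite -[c1 - w](subrKA a); apply: le_trans (ler_normD _ _) _.
  by rewrite lerD// distrC.
have excess : `|c1 - w| - k * r <= 2 * (k * s) by lra.
have h1 := ler_wpM2l kappa0 excess.
have h2 := ler_wpM2r s0 gammaP.
rewrite distrC in ac1; lra.
Qed.

(** Helly's theorem on [F y], for the conditions defining [F2 y] together with
    a ball around [a]. *)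
Lemma second_refinement_lipschitz x y a : F2 x a ->
  exists2 b, F2 y b & (`|a - b|%:E <= gamma%:E * rho x y)%E.
Proof.
move=> F2a.
pose S (o : option M) := match o with
  | None => minkowski_sum [set a] (cball0 X (gamma%:E * rho x y)%E)
  | Some z => minkowski_sum (F1 z) (cball0 X (k%:E * rho y z)%E) end.
have [|||b Fb Sb] := helly_K1 (S := S) (hF y).
- case=> [z|]; apply: nbhd_closed; first exact: first_refinement_compact.
  exact: compact_set1.
- case=> [z|]; apply: nbhd_segment_closed.
    exact: first_refinement_segment_closed.
  by move=> _ _ t -> -> _; rewrite subrr scaler0 addr0.
- have SN z : exists c, [/\ F y c, S (Some z) c & S None c].
    have [c [Fc Sc ca]] := second_refinement_approx y z F2a.
    by exists c; split=> //; apply/nbhdP; exists a.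
  move=> [z|] [z'|].
  + exact: second_refinement_conditions_meet.
  + exact: SN.
  + by have [c [? ? ?]] := SN z'; exists c.
  + by have [c [? ? ?]] := SN y; exists c.
exists b; first by move=> z _; exact: (Sb (Some z)).
by have /nbhdP[_ -> /within_sym] := Sb None.
Qed.

(** The norm enters only through its retraction bound. *)
Lemma core_property_of_retraction : core_property rho F l k gamma.
Proof.
split=> [x|x y]; first exact: second_refinement_nonempty.
have := rho_ge0 x y; case sE: (rho x y) => [s| |] //; last first.
  by move=> _; rewrite gt0_muley ?lte_fin ?leey.
rewrite lee_fin => s0; apply/lee_addgt0Pr => e e0.
(* Radii in the Hausdorff distance are positive, hence the margin [e]. *)
apply: ereal_inf_lbound; exists (gamma * s + e); last by rewrite EFinD EFinM.
have gse : (gamma%:E * rho x y <= (gamma * s + e)%:E)%E.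
  by rewrite sE -EFinM lee_fin lerDl ltW.
split.
- by rewrite ltr_wpDl// mulr_ge0// ltW.
- move=> b F2b; have [a F2a ba] := second_refinement_lipschitz x F2b.
  apply/nbhdP; exists a => //.
  by apply: le_trans gse; rewrite -(rhoC y).
- move=> a F2a; have [b F2b ab] := second_refinement_lipschitz y F2a.
  apply/nbhdP; exists b => //.
  exact: le_trans gse.
Qed.

End Refinement.

(** * The two families of constants *)

Theorem theorem1p10 (R : realType) (X : completeNormedModType R)
    (hX : dim_gt1 X) (M : Type) (rho : M -> M -> \bar R)
    (hrho : is_pseudometric rho) (F : M -> set X) (hF : forall x, K1 X (F x))
    (hsel : forall M' : set M, (M' #<= `I_4)%card ->
       exists f : M -> X,
         selection_on F M' f /\ (lip_seminorm rho M' f <= 1)%E) :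
  ((forall l1 l2 gamma : R,
      1 <= l1 -> 3 * l1 <= l2 ->
      l2 * ((3 * l2 + l1) / (l2 - l1)) <= gamma ->
      core_property rho F l1 l2 gamma) /\
   core_property rho F 1 3 15) /\
  (euclidean X ->
   (forall l1 l2 gamma : R,
      1 <= l1 -> 3 * l1 <= l2 ->
      l2 + 2 * l2 ^+ 2 / Num.sqrt (l2 ^+ 2 - l1 ^+ 2) <= gamma ->
      core_property rho F l1 l2 gamma) /\
   core_property rho F 1 3 10).
Proof.
have normed_case (l k gamma : R) : 1 <= l -> 3 * l <= k ->
    k * ((3 * k + l) / (k - l)) <= gamma -> core_property rho F l k gamma.
  move=> l1 lk gammaP.
  have l0 : 0 < l := lt_le_trans ltr01 l1.
  have ltlk : l < k by lra.
  have kl0 : k - l != 0 by rewrite subr_eq0 gt_eqF.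
  apply: (core_property_of_retraction hrho hF hsel l1 lk _
           (normed_retraction_bound l0 ltlk)).
    by rewrite divr_ge0 ?subr_ge0 ?(ltW ltlk)//; lra.
  suff <- : k * ((3 * k + l) / (k - l)) =
            k * (1 + 2 * ((k + l) / (k - l))) by [].
  by field.
have euclid_case (l k gamma : R) : euclidean X -> 1 <= l -> 3 * l <= k ->
    k + 2 * k ^+ 2 / Num.sqrt (k ^+ 2 - l ^+ 2) <= gamma ->
    core_property rho F l k gamma.
  move=> eX l1 lk gammaP.
  have l0 : 0 < l := lt_le_trans ltr01 l1.
  have ltlk : l < k by lra.
  apply: (core_property_of_retraction hrho hF hsel l1 lk _
           (euclidean_retraction_bound l0 ltlk eX)).
    by rewrite divr_ge0 ?sqrtr_ge0//; lra.
  rewrite (_ : k * _ = k + 2 * k ^+ 2 / Num.sqrt (k ^+ 2 - l ^+ 2))//; ring.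
have one_three : 3 * 1 <= 3 :> R by rewrite mulr1.
split.
  by split=> //; apply: normed_case; rewrite ?mulrA ?ler_pdivrMr; lra.
move=> eX; split; first by move=> *; exact: euclid_case.
apply: euclid_case => //.
(* [3 + 18 / sqrt 8 <= 10] amounts to [18 / 7 <= sqrt 8]. *)
have s : 18 / 7 <= Num.sqrt (3 ^+ 2 - 1 ^+ 2 : R).
  by rewrite -(@ler_pXn2r _ 2) ?nnegrE ?sqrtr_ge0 ?sqr_sqrtr//; lra.
have s0 : 0 < Num.sqrt (3 ^+ 2 - 1 ^+ 2 : R) by apply: lt_le_trans s; lra.
rewrite -lerBrDl ler_pdivrMr//; move: s; lra.
Qed.
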